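(* Let $G$ and $H$ be finite simple graphs. There exist a chain map $\psi$ from the complex $\Omega^*_{dR}(G\times H)=\Omega^*(G)\otimes\Omega^*(H)$ to the complex $\Omega^*(G\times H)$ and a chain map $\phi:\Omega^*(G\times H)\to\Omega^*_{dR}(G\times H)$ such that $\phi$ and $\psi$ are inverse to each other up to chain homotopy (so the two complexes are chain homotopy equivalent).
   Context: Product: for finite simple graphs $G,H$, the graph $G\times H$ has as vertices all pairs $(x,y)$ with $x$ a nonempty complete subgraph (simplex, identified with its vertex set) of $G$ and $y$ a nonempty complete subgraph of $H$. Two distinct vertices $(x,y)\neq(x',y')$ are adjacent iff ($x\subseteq x'$ and $y\subseteq y'$) or ($x'\subseteq x$ and $y'\subseteq y$). Whitney complex: for a finite simple graph $G$, let the $k$-simplices be the complete subgraphs $K_{k+1}$ of $G$, each with a fixed orientation. $\Omega^k(G)$ is the finite-dimensional real vector space of functions on $k$-simplices, extended antisymmetrically to orderings of their vertices, with exterior derivative $d_k:\Omega^k(G)\to\Omega^{k+1}(G)$, $d_kf(x_0,\dots,x_{k+1})=\sum_l(-1)^l f(x_0,\dots,\hat{x}_l,\dots,x_{k+1})$. De Rham complex: $\Omega^k_{dR}(G\times H)=\bigoplus_{i+j=k}\Omega^i(G)\otimes\Omega^j(H)$ with derivative $d(f\otimes g)=df\otimes g+(-1)^{i}f\otimes dg$ for $f\in\Omega^i(G)$. A chain map is a degree-preserving linear map commuting with the derivatives $d$. Two chain maps $\alpha,\beta:A^*\to B^*$ are chain homotopic if $\alpha-\beta=d\theta+\theta d$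 for some linear map $\theta$ of degree $-1$. *)

(* Defs.v *)
From HB Require Import structures.
From mathcomp Require Import all_boot all_order all_fingroup all_algebra.
From mathcomp Require Import reals zify.
Set Implicit Arguments.
Unset Strict Implicit.
Unset Printing Implicit Defensive.

Import GRing.Theory VectorInternalTheory.
Local Open Scope ring_scope.

Record sgraph := SGraph {
  vert :> finType;
  adj : rel vert;
  adj_sym : symmetric adj;
  adj_irr : irreflexive adj }.

Definition complete (G : sgraph) (x : {set G}) : bool :=
  [forall u in x, forall v in x, (u != v) ==> adj u v].

Record simplex (G : sgraph) := Simplex {
  simplex_set :> {set G};
  simplexP : (simplex_set != set0) && complete simplex_set }.
HB.instance Definition _ G := [isSub for @simplex_set G].
HB.instance Definition _ G := [Finite of simplex G by <:].

Section ProductGraph.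
Variables G H : sgraph.

Definition prod_vert : finType := (simplex G * simplex H)%type.

Definition prod_sub (p q : prod_vert) : bool :=
  (simplex_set p.1 \subset simplex_set q.1) &&
  (simplex_set p.2 \subset simplex_set q.2).

Definition prod_adj (p q : prod_vert) : bool :=
  (p != q) && (prod_sub p q || prod_sub q p).

Lemma prod_adj_sym : symmetric prod_adj.
Proof. by move=> p q; rewrite /prod_adj eq_sym orbC. Qed.

Lemma prod_adj_irr : irreflexive prod_adj.
Proof. by move=> p; rewrite /prod_adj eqxx. Qed.

Definition prod_graph : sgraph := SGraph prod_adj_sym prod_adj_irr.

End ProductGraph.

Record cochain_complex (F : fieldType) := CochainComplex {
  cspace :> nat -> vectType F;
  cdiff : forall k, 'Hom(cspace k, cspace k.+1);
  cdiff_sq : forall k, (cdiff k.+1 \o cdiff k)%VF = 0 }.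
Arguments cdiff {F} c k.

Section ChainMaps.
Variable F : fieldType.

Record chain_map (A B : cochain_complex F) := ChainMap {
  cmap :> forall k, 'Hom(A k, B k);
  cmap_comm : forall k, (cdiff B k \o cmap k = cmap k.+1 \o cdiff A k)%VF }.

Lemma chain_id_comm (A : cochain_complex F) k :
  (cdiff A k \o \1 = \1 \o cdiff A k)%VF.
Proof. by rewrite comp_lfun1l comp_lfun1r. Qed.

Definition chain_id (A : cochain_complex F) : chain_map A A :=
  ChainMap (@chain_id_comm A).

Lemma chain_comp_comm (A B C : cochain_complex F)
    (f : chain_map B C) (g : chain_map A B) k :
  (cdiff C k \o (f k \o g k) = (f k.+1 \o g k.+1) \o cdiff A k)%VF.
Proof. by rewrite comp_lfunA cmap_comm -comp_lfunA cmap_comm comp_lfunA. Qed.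

Definition chain_comp (A B C : cochain_complex F)
    (f : chain_map B C) (g : chain_map A B) : chain_map A C :=
  ChainMap (chain_comp_comm f g).

(* The complexes live in degrees >= 0, so the term [d theta] is absent in
   degree 0. *)
Definition chain_homotopic (A B : cochain_complex F) (f g : chain_map A B) :=
  exists theta : forall k, 'Hom(A k.+1, B k),
    f 0%N - g 0%N = (theta 0%N \o cdiff A 0%N)%VF /\
    forall k, f k.+1 - g k.+1 =
      (cdiff B k \o theta k)%VF + (theta k.+1 \o cdiff A k.+1)%VF.

End ChainMaps.

Section OrderedSimplices.
Variable G : sgraph.

(* A k-simplex (complete subgraph K_{k+1}) with an ordering of its vertices *)
Record osimplex k := OSimplex {
  oseq :> {ffun 'I_k.+1 -> G};
  osimplexP : injectiveb oseq && complete [set oseq i | i : 'I_k.+1] }.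
HB.instance Definition _ k := [isSub for @oseq k].
HB.instance Definition _ k := [Finite of osimplex k by <:].

Lemma osimplex_sub m n (x : osimplex n) (h : 'I_m.+1 -> 'I_n.+1) :
  injective h ->
  let y := [ffun i => x (h i)] in
  injectiveb y && complete [set y i | i : 'I_m.+1].
Proof.
move=> h_inj /=; have /andP[/injectiveP x_inj /forall_inP x_cpl] := osimplexP x.
apply/andP; split.
  by apply/injectiveP=> i j; rewrite !ffunE => /x_inj /h_inj.
have in_x i : [ffun i0 => x (h i0)] i \in [set x i0 | i0 : 'I_n.+1].
  by rewrite ffunE imset_f.
apply/forall_inP=> u /imsetP[i _ ->]; apply/forall_inP=> v /imsetP[j _ ->].
exact: (forall_inP (x_cpl _ (in_x i))).
Qed.

(* [lift l] skips l: the vertex x_l is deleted. *)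
Definition oface k (l : 'I_k.+2) (x : osimplex k.+1) : osimplex k :=
  OSimplex (osimplex_sub x (@lift_inj _ l)).

Definition operm k (s : 'S_k.+1) (x : osimplex k) : osimplex k :=
  OSimplex (osimplex_sub x (@perm_inj _ s)).

End OrderedSimplices.

Lemma lift_perm_exists n (s : 'S_n.+1) l : exists t, s = lift_perm l (s l) t.
Proof.
pose g k := odflt k (unlift (s l) (s (lift l k))).
have gK k : lift (s l) (g k) = s (lift l k).
  rewrite /g; have := neq_lift l k.
  by rewrite -(can_eq (permK s)) => /unlift_some[] ? ? ->.
have g_inj : injective g.
  by move=> i j eq_g; apply/(@lift_inj _ l)/(@perm_inj _ s); rewrite -!gK eq_g.
exists (perm g_inj); apply/permP=> k.
by case: (unliftP l k) => [j|] ->; rewrite ?lift_perm_id // lift_perm_lift permE.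
Qed.

Section Whitney.
Variables (F : fieldType) (G : sgraph).

Definition altdefect k (s : 'S_k.+1) (f : {ffun osimplex G k -> F^o}) :
  {ffun osimplex G k -> F^o} := [ffun x => f (operm s x) - (-1) ^+ s * f x].

Definition altforms k : {vspace {ffun osimplex G k -> F^o}} :=
  (\bigcap_(s : 'S_k.+1) lker (linfun (altdefect s)))%VS.

(* Omega^k(G): functions on k-simplices, each represented by its antisymmetric
   extension to all vertex orderings ([altformsP]). No orientation of the
   simplices has to be fixed: see [forms_orientation]. *)
Definition forms k : vectType F := subvs_of (altforms k).

Definition rawdiff k (f : {ffun osimplex G k -> F^o}) :
    {ffun osimplex G k.+1 -> F^o} :=
  [ffun x => \sum_(l < k.+2) (-1) ^+ l * f (oface l x)].

(* The projection [vsproj] only retypes its argument: see [extdiffE]. *)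
Definition extdiff k : 'Hom(forms k, forms k.+1) :=
  linfun (vsproj (altforms k.+1) \o @rawdiff k \o vsval).

Fact altdefect_is_linear k s : linear (@altdefect k s).
Proof.
move=> a f g; apply/ffunP=> x; rewrite !ffunE.
by rewrite mulrDr opprD addrACA mulrCA -mulrBr.
Qed.
HB.instance Definition _ k s :=
  GRing.isLinear.Build F _ _ _ (@altdefect k s) (@altdefect_is_linear k s).

Lemma altformsP k (f : {ffun osimplex G k -> F^o}) :
  reflect (forall s x, f (operm s x) = (-1) ^+ s * f x) (f \in altforms k).
Proof.
rewrite memvE; apply: (iffP subv_bigcapP) => [f_alt s x | f_alt s _].
  have := f_alt s isT; rewrite -memvE memv_ker lfunE /= => /eqP/ffunP/(_ x).
  by rewrite !ffunE => /eqP; rewrite subr_eq0 => /eqP.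
rewrite -memvE memv_ker lfunE /=; apply/eqP/ffunP=> x.
by rewrite !ffunE f_alt subrr.
Qed.

Lemma rawdiff_alt k (f : {ffun osimplex G k -> F^o}) :
  f \in altforms k -> rawdiff f \in altforms k.+1.
Proof.
move=> /altformsP f_alt; apply/altformsP=> s x; rewrite !ffunE mulr_sumr.
rewrite [RHS](reindex_inj (@perm_inj _ s)) /=; apply: eq_bigr => l _.
have [t def_s] := lift_perm_exists s l.
have -> : oface l (operm s x) = operm t (oface (s l) x).
  by apply/val_inj/ffunP=> i; rewrite !ffunE {1}def_s lift_perm_lift.
rewrite f_alt !mulrA; congr (_ * _).
have := odd_lift_perm l (s l) t; rewrite -def_s => ->.
rewrite -(signr_odd _ l) -(signr_odd _ (s l)) -!signr_addb.
by case: (odd l) (odd (s l)) (odd_perm t) => [] [] [].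
Qed.

Fact rawdiff_is_linear k : linear (@rawdiff k).
Proof.
move=> a f g; apply/ffunP=> x; rewrite !ffunE scaler_sumr -big_split /=.
by apply: eq_bigr => l _; rewrite !ffunE mulrDr scalerAr.
Qed.
HB.instance Definition _ k :=
  GRing.isLinear.Build F _ _ _ (@rawdiff k) (@rawdiff_is_linear k).

Lemma extdiffE k (f : forms k) (x : osimplex G k.+1) :
  vsval (extdiff k f) x = \sum_(l < k.+2) (-1) ^+ l * vsval f (oface l x).
Proof. by rewrite lfunE /= vsprojK ?ffunE // rawdiff_alt // subvsP. Qed.

Lemma rawdiff_sq k (f : {ffun osimplex G k -> F^o}) : rawdiff (rawdiff f) = 0.
Proof.
apply/ffunP=> x; rewrite !ffunE.
under eq_bigr => l _ do rewrite ffunE mulr_sumr.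
rewrite pair_big /= (bigID [pred p : 'I_k.+3 * 'I_k.+2 | p.2 < p.1]%N) /=.
pose h (p : 'I_k.+3 * 'I_k.+2) : 'I_k.+3 * 'I_k.+2 := (inord p.2.+1, inord p.1).
pose h' (p : 'I_k.+3 * 'I_k.+2) : 'I_k.+3 * 'I_k.+2 := (inord p.2, inord p.1.-1).
rewrite (reindex_onto h h') /=; last first.
  move=> [[l lb] [m mb]] /= ml; rewrite /h /h'; congr (_, _); apply/val_inj.
    by rewrite /= !inordK /=; lia.
  by rewrite /= !inordK /=; lia.
apply/eqP; rewrite addr_eq0 -sumrN; apply/eqP.
have h_cond p : ((h p).2 < (h p).1)%N && (h' (h p) == p) = ~~ (p.2 < p.1)%N.
  case: p => [[l lb] [m mb]]; rewrite /h /h' /= -leqNgt.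
  have [lm|ml] := leqP l m.
    rewrite !inordK /=; [|lia..]; rewrite ltnS lm /=; apply/eqP.
    by congr (_, _); apply/val_inj; rewrite /= inordK.
  set a : 'I_k.+2 := inord l; have a_lt := ltn_ord a.
  apply/negbTE/negP => /andP[+ /eqP[+ _]].
  move=> + /(congr1 val) /=; clearbody a; rewrite !inordK; lia.
apply: eq_big => [|p]; first exact: h_cond.
rewrite h_cond; case: p => [[l lb] [m mb]] /=; rewrite -leqNgt => lm.
rewrite !inordK /=; [|lia..].
rewrite exprS mulN1r mulNr mulrCA; congr (- (_ * (_ * f _))).
apply/val_inj/ffunP=> i; rewrite !ffunE; congr (x _); apply/val_inj.
by rewrite /= /bump !inordK /=; lia.
Qed.

Lemma extdiff_sq k : (extdiff k.+1 \o extdiff k)%VF = 0.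
Proof.
apply/lfunP=> f; rewrite comp_lfunE zero_lfunE; apply/val_inj.
have -> : val (extdiff k.+1 (extdiff k f)) = rawdiff (rawdiff (vsval f)).
  by rewrite !lfunE /= !vsprojK // ?rawdiff_alt // subvsP.
exact: rawdiff_sq.
Qed.

Definition whitney : cochain_complex F := CochainComplex extdiff_sq.

End Whitney.

Section Orientation.
Variables (F : fieldType) (G : sgraph) (k : nat).
Implicit Types x y : osimplex G k.

Definition osupp x : {set G} := [set x i | i : 'I_k.+1].

Lemma osupp_operm x y : osupp x = osupp y -> exists s, x = operm s y.
Proof.
move=> eq_xy; have x_inj := injectiveP _ (proj1 (andP (osimplexP x))).
have in_y i : exists j, y j == x i.
  have : x i \in osupp y by rewrite -eq_xy imset_f.
  by case/imsetP=> j _ ->; exists j.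
pose g i := xchoose (in_y i).
have gP i : y (g i) = x i by apply/eqP; exact: (xchooseP (in_y i)).
have g_inj : injective g by move=> i j eq_g; apply: x_inj; rewrite -!gP eq_g.
by exists (perm g_inj); apply/val_inj/ffunP=> i; rewrite ffunE permE gP.
Qed.

Lemma operm_inj x : injective (fun s => operm s x).
Proof.
move=> s t /(congr1 val)/ffunP eq_st; apply/permP=> i.
have x_inj := injectiveP _ (proj1 (andP (osimplexP x))).
by apply: x_inj; have := eq_st i; rewrite !ffunE.
Qed.

Lemma operm_comp s t x : operm s (operm t x) = operm (s * t)%g x.
Proof. by apply/val_inj/ffunP=> i; rewrite !ffunE permM. Qed.

Lemma osupp_opermE s x : osupp (operm s x) = osupp x.
Proof.
apply/setP=> u; apply/imsetP/imsetP=> -[i _ ->].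
  by exists (s i); rewrite ?ffunE.
by exists (s^-1 i)%g; rewrite // ffunE permKV.
Qed.

(* Whatever orientation [o] is fixed on the k-simplices, a k-form is the same
   as an arbitrary function on k-simplices. *)
Lemma forms_orientation (o : {set G} -> osimplex G k)
    (oP : forall x, osupp (o (osupp x)) = osupp x) (g : {set G} -> F) :
  exists! f : forms F G k, forall x, vsval f (o (osupp x)) = g (osupp x).
Proof.
have ex_s x : exists s, x == operm s (o (osupp x)).
  by have [s ->] := osupp_operm (esym (oP x)); exists s; rewrite osupp_opermE oP.
pose sg x := xchoose (ex_s x).
have sgP x : x = operm (sg x) (o (osupp x)).
  by apply/eqP; exact: (xchooseP (ex_s x)).
pose f : {ffun osimplex G k -> F^o} := [ffun x => (-1) ^+ sg x * g (osupp x)].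
have f_alt : f \in altforms F G k.
  apply/altformsP=> s x; rewrite !ffunE osupp_opermE mulrA; congr (_ * _).
  have -> : sg (operm s x) = (s * sg x)%g.
    apply: (@operm_inj (o (osupp x))); rewrite -operm_comp -sgP.
    by have /esym := sgP (operm s x); rewrite osupp_opermE.
  by rewrite odd_permM signr_addb.
exists (vsproj _ f); split=> [x|f' f'P].
  rewrite vsprojK // ffunE oP.
  have -> : sg (o (osupp x)) = 1%g.
    apply: (@operm_inj (o (osupp x))); have /esym := sgP (o (osupp x)).
    rewrite oP => ->.
    by apply/val_inj/ffunP=> i; rewrite ffunE perm1.
  by rewrite odd_perm1 mul1r.
apply/val_inj/ffunP=> x /=; rewrite vsprojK // ffunE.
by rewrite {3}[x]sgP (altformsP _ (subvsP f')) f'P.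
Qed.

End Orientation.

Section Tensor.
Variable F : fieldType.
Implicit Types U V W : vectType F.

(* Realized in coordinates, on the basis of products of the basis vectors
   underlying [v2r]; [tensor_bilinear] and [tensor_universal] give the universal
   property, and [thomE] the action of a tensor product of linear maps. *)
Definition tensor U V : vectType F := 'M[F]_(dim U, dim V).

Definition tpure U V (u : U) (v : V) : tensor U V := (v2r u)^T *m v2r v.

Definition thom U U' V V' (f : 'Hom(U, U')) (g : 'Hom(V, V')) :
    'Hom(tensor U V, tensor U' V') :=
  linfun (mulmxr (f2mx g) \o mulmx (f2mx f)^T).

Lemma v2r_lfun U V (f : 'Hom(U, V)) u : v2r (f u) = v2r u *m f2mx f.
Proof. by rewrite unlock /= r2vK. Qed.

Lemma thomE U U' V V' (f : 'Hom(U, U')) (g : 'Hom(V, V')) u v :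
  thom f g (tpure u v) = tpure (f u) (g v).
Proof. by rewrite lfunE /= /tpure !v2r_lfun trmx_mul !mulmxA. Qed.

Lemma tensor_bilinear U V a (u u' : U) (v v' : V) :
  tpure (a *: u + u') v = a *: tpure u v + tpure u' v /\
  tpure u (a *: v + v') = a *: tpure u v + tpure u v'.
Proof.
rewrite /tpure !linearP /=; split=> //.
by rewrite mulmxDl scalemxAl.
Qed.

Lemma tensor_delta U V (t : tensor U V) :
  t = \sum_i \sum_j (t : 'M_(_, _)) i j *:
        tpure (r2v (delta_mx 0 i)) (r2v (delta_mx 0 j)).
Proof.
rewrite [LHS]matrix_sum_delta; apply: eq_bigr => i _; apply: eq_bigr => j _.
by rewrite /tpure !r2vK trmx_delta mul_delta_mx.
Qed.

Lemma tensor_ext U V W (f g : 'Hom(tensor U V, W)) :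
  (forall u v, f (tpure u v) = g (tpure u v)) -> f = g.
Proof.
move=> eq_fg; apply/lfunP=> t; rewrite [t]tensor_delta !linear_sum.
apply: eq_bigr => i _; rewrite !linear_sum; apply: eq_bigr => j _.
by rewrite !linearZ /= eq_fg.
Qed.

Lemma tensor_universal U V W (b : U -> V -> W) :
    (forall v, linear (b^~ v)) -> (forall u, linear (b u)) ->
  exists! f : 'Hom(tensor U V, W), forall u v, f (tpure u v) = b u v.
Proof.
move=> bl br.
pose bL v : {linear U -> W} :=
  HB.pack (b^~ v) (GRing.isLinear.Build _ _ _ _ _ (bl v)).
pose bR u : {linear V -> W} :=
  HB.pack (b u) (GRing.isLinear.Build _ _ _ _ _ (br u)).
pose g (t : 'M[F]_(dim U, dim V)) := \sum_i \sum_j t i j *: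
   b (r2v (delta_mx 0 i)) (r2v (delta_mx 0 j)).
have g_lin : linear (g : tensor U V -> W).
  move=> a s t; rewrite /g scaler_sumr -big_split; apply: eq_bigr => i _ /=.
  rewrite scaler_sumr -big_split; apply: eq_bigr => j _ /=.
  by rewrite !mxE scalerDl scalerA.
pose gL : {linear tensor U V -> W} :=
  HB.pack (g : tensor U V -> W) (GRing.isLinear.Build _ _ _ _ _ g_lin).
have gP u v : linfun gL (tpure u v) = b u v.
  rewrite lfunE /= /g -{2}[u]v2rK [v2r u]row_sum_delta linear_sum.
  rewrite -[RHS]/(bL v _) linear_sum; apply: eq_bigr => i _.
  rewrite !linearZ /= -{2}[v]v2rK [v2r v in RHS]row_sum_delta linear_sum.
  rewrite -[b _ _ in RHS]/(bR _ _) linear_sum scaler_sumr.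
  apply: eq_bigr => j _; rewrite !linearZ /= scalerA; congr (_ *: _).
  by rewrite mxE big_ord1 mxE mulrC.
exists (linfun gL); split=> // f fP.
by apply: tensor_ext => u v; rewrite fP gP.
Qed.

Lemma thom_comp U U' U'' V V' V'' (f' : 'Hom(U', U'')) (f : 'Hom(U, U'))
    (g' : 'Hom(V', V'')) (g : 'Hom(V, V')) :
  (thom f' g' \o thom f g)%VF = thom (f' \o f)%VF (g' \o g)%VF.
Proof. by apply: tensor_ext => u v; rewrite comp_lfunE !thomE !comp_lfunE. Qed.

Lemma thom0l U U' V V' (g : 'Hom(V, V')) : thom (0 : 'Hom(U, U')) g = 0.
Proof.
by apply: tensor_ext => u v; rewrite thomE !zero_lfunE /tpure !linear0 mul0mx.
Qed.

Lemma thom0r U U' V V' (f : 'Hom(U, U')) : thom f (0 : 'Hom(V, V')) = 0.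
Proof.
by apply: tensor_ext => u v; rewrite thomE !zero_lfunE /tpure !linear0.
Qed.

End Tensor.

Section DirectSum.
Variables (F : fieldType) (I : finType) (V : I -> vectType F).

Definition dsum := {dffun forall i, V i}.
HB.instance Definition _ := Choice.on dsum.
Implicit Types f g h : dsum.

Definition dsum_zero : dsum := [ffun i => 0 : V i].
Definition dsum_opp f : dsum := [ffun i => - f i : V i].
Definition dsum_add f g : dsum := [ffun i => f i + g i : V i].
Definition dsum_scale a f : dsum := [ffun i => a *: f i : V i].

Fact dsum_addA : associative dsum_add.
Proof. by move=> f g h; apply/ffunP=> i; rewrite !ffunE addrA. Qed.
Fact dsum_addC : commutative dsum_add.
Proof. by move=> f g; apply/ffunP=> i; rewrite !ffunE addrC. Qed.
Fact dsum_add0 : left_id dsum_zero dsum_add.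
Proof. by move=> f; apply/ffunP=> i; rewrite !ffunE add0r. Qed.
Fact dsum_addN : left_inverse dsum_zero dsum_opp dsum_add.
Proof. by move=> f; apply/ffunP=> i; rewrite !ffunE addNr. Qed.
HB.instance Definition _ :=
  GRing.isZmodule.Build dsum dsum_addA dsum_addC dsum_add0 dsum_addN.

Fact dsum_scaleA a b f : dsum_scale a (dsum_scale b f) = dsum_scale (a * b) f.
Proof. by apply/ffunP=> i; rewrite !ffunE scalerA. Qed.
Fact dsum_scale1 : left_id 1 dsum_scale.
Proof. by move=> f; apply/ffunP=> i; rewrite !ffunE scale1r. Qed.
Fact dsum_scaleDr : right_distributive dsum_scale +%R.
Proof. by move=> a f g; apply/ffunP=> i; rewrite !ffunE scalerDr. Qed.
Fact dsum_scaleDl f : {morph dsum_scale^~ f : a b / a + b}.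
Proof. by move=> a b; apply/ffunP=> i; rewrite !ffunE scalerDl. Qed.
HB.instance Definition _ := GRing.Zmodule_isLmodule.Build F dsum
  dsum_scaleA dsum_scale1 dsum_scaleDr dsum_scaleDl.

Fact dsum_vect_iso : Vector.axiom #|{: {i : I & 'I_(dim (V i))}}| dsum.
Proof.
pose to f := \row_a v2r (f (tag (enum_val a))) 0 (tagged (enum_val a))
  : 'rV[F]_#|{: {i : I & 'I_(dim (V i))}}|.
pose of_ (r : 'rV[F]_#|{: {i : I & 'I_(dim (V i))}}|) : dsum :=
  [ffun i => r2v (\row_a r 0 (enum_rank (Tagged _ a))) : V i].
exists to; first by move=> a f g; apply/rowP=> j; rewrite !mxE !ffunE linearP !mxE.
exists of_ => [f|r].
  apply/ffunP=> i; rewrite ffunE -[RHS]v2rK; congr (r2v _).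
  by apply/rowP=> a; rewrite !mxE enum_rankK.
apply/rowP=> j; rewrite mxE ffunE r2vK mxE.
by case: (enum_val j) (enum_valK j) => i a /= ->.
Qed.
HB.instance Definition _ := Lmodule_hasFinDim.Build F dsum dsum_vect_iso.

Definition dcoord i f : V i := f i.
Fact dcoord_is_linear i : linear (dcoord i).
Proof. by move=> a f g; rewrite /dcoord !ffunE. Qed.
HB.instance Definition _ i :=
  GRing.isLinear.Build F _ _ _ (dcoord i) (@dcoord_is_linear i).

Definition dsingle i (v : V i) : dsum :=
  [ffun j => dfwith (fun j => 0 : V j) v j].
Fact dsingle_is_linear i : linear (@dsingle i).
Proof.
move=> a u v; apply/ffunP=> j; rewrite !ffunE.
have [<-|ij] := eqVneq i j; first by rewrite !dfwith_in.
by rewrite !dfwith_out // scaler0 addr0.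
Qed.
HB.instance Definition _ i :=
  GRing.isLinear.Build F _ _ _ (@dsingle i) (@dsingle_is_linear i).

Definition dproj i : 'Hom(dsum, V i) := linfun (dcoord i).
Definition dinj i : 'Hom(V i, dsum) := linfun (@dsingle i).

Lemma dprojE i f : dproj i f = f i. Proof. exact: lfunE. Qed.

Lemma dinjK i : (dproj i \o dinj i)%VF = \1%VF.
Proof.
by apply/lfunP=> v; rewrite comp_lfunE !lfunE /= /dcoord ffunE dfwith_in.
Qed.

Lemma dinj_neq i j : i != j -> (dproj j \o dinj i)%VF = 0.
Proof.
move=> ij; apply/lfunP=> v.
by rewrite comp_lfunE !lfunE /= /dcoord ffunE dfwith_out.
Qed.

Lemma dsum_sum : (\sum_i (dinj i \o dproj i))%VF = \1%VF.
Proof.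
apply/lfunP=> f; rewrite sum_lfunE id_lfunE; apply/ffunP=> j.
rewrite -[LHS]/(dcoord j _) linear_sum (bigD1 j) //= big1 => [|i ij].
  by rewrite addr0 comp_lfunE !lfunE /= /dcoord ffunE dfwith_in.
by rewrite comp_lfunE !lfunE /= /dcoord ffunE dfwith_out.
Qed.

End DirectSum.

Section TensorComplex.
Variables (F : fieldType) (A B : cochain_complex F).

Definition bideg k := {p : 'I_k.+1 * 'I_k.+1 | p.1 + p.2 == k}%N.

Fact bidegS1 k (p : bideg k) : ((val p).1.+1 + (val p).2 == k.+1)%N.
Proof. by rewrite addSn eqSS (valP p). Qed.

Fact bidegS2 k (p : bideg k) : ((val p).1 + (val p).2.+1 == k.+1)%N.
Proof. by rewrite addnS eqSS (valP p). Qed.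

Definition bidegL k (p : bideg k) : bideg k.+1 :=
  let i : 'I_k.+2 := Ordinal (ltn_ord (val p).1 : (val p).1.+1 < k.+2)%N in
  exist _ (i, widen_ord (leqnSn _) (val p).2) (bidegS1 p).

Definition bidegR k (p : bideg k) : bideg k.+1 :=
  let j : 'I_k.+2 := Ordinal (ltn_ord (val p).2 : (val p).2.+1 < k.+2)%N in
  exist _ (widen_ord (leqnSn _) (val p).1, j) (bidegS2 p).

Definition tspace k : vectType F :=
  dsum (fun p : bideg k => tensor (A (val p).1) (B (val p).2)).

Definition tinj k (p : bideg k) :
  'Hom(tensor (A (val p).1) (B (val p).2), tspace k) := dinj _ p.
Definition tproj k (p : bideg k) :
  'Hom(tspace k, tensor (A (val p).1) (B (val p).2)) := dproj _ p.

(* d (f (x) g) = df (x) g + (-1)^i f (x) dg on the summand A^i (x) B^j *)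
Definition tdiff_at k (p : bideg k) :
    'Hom(tensor (A (val p).1) (B (val p).2), tspace k.+1) :=
  (tinj (bidegL p) \o thom (cdiff A (val p).1) \1)%VF
  + (-1) ^+ (val p).1 *: (tinj (bidegR p) \o thom \1 (cdiff B (val p).2))%VF.

Definition tdiff k : 'Hom(tspace k, tspace k.+1) :=
  \sum_(p : bideg k) (tdiff_at p \o tproj p)%VF.

Lemma tdiff_inj k (p : bideg k) : (tdiff k \o tinj p)%VF = tdiff_at p.
Proof.
apply/lfunP=> t; rewrite comp_lfunE sum_lfunE (bigD1 p) //= big1 => [|q qp].
  by rewrite addr0 -comp_lfunE -comp_lfunA dinjK comp_lfun1r.
by rewrite -comp_lfunE -comp_lfunA dinj_neq 1?eq_sym // comp_lfun0r zero_lfunE.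
Qed.

Lemma tdiff_pure k (p : bideg k) (f : A (val p).1) (g : B (val p).2) :
  tdiff k (tinj p (tpure f g)) =
    tinj (bidegL p) (tpure (cdiff A _ f) g)
    + (-1) ^+ (val p).1 *: tinj (bidegR p) (tpure f (cdiff B _ g)).
Proof.
rewrite -comp_lfunE tdiff_inj /tdiff_at add_lfunE scale_lfunE !comp_lfunE !thomE.
by rewrite !id_lfunE.
Qed.

Lemma tinj_irr k i j (hi hi' : (i < k.+1)%N) (hj hj' : (j < k.+1)%N)
    (h h' : (i + j == k)%N) :
  tinj (exist _ (Ordinal hi, Ordinal hj) h : bideg k) =
  tinj (exist _ (Ordinal hi', Ordinal hj') h' : bideg k)
    :> 'Hom(tensor (A i) (B j), tspace k).
Proof.
by rewrite (bool_irrelevance hi hi') (bool_irrelevance hj hj')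
  (bool_irrelevance h h').
Qed.

Lemma cdiff_sqE (C : cochain_complex F) k (f : C k) :
  cdiff C k.+1 (cdiff C k f) = 0.
Proof. by rewrite -comp_lfunE cdiff_sq zero_lfunE. Qed.

Lemma tdiff_sq k : (tdiff k.+1 \o tdiff k)%VF = 0.
Proof.
suff sq0 (p : bideg k) : (tdiff k.+1 \o tdiff k \o tinj p)%VF = 0.
  rewrite -[LHS]comp_lfun1r -dsum_sum; apply/lfunP=> t.
  rewrite comp_lfunE sum_lfunE linear_sum zero_lfunE big1 // => p _ /=.
  by rewrite -comp_lfunE comp_lfunA sq0 comp_lfun0l zero_lfunE.
apply: tensor_ext => u v; rewrite zero_lfunE !comp_lfunE tdiff_pure.
have /= dL := tdiff_pure (p := bidegL p) (cdiff A _ u) v.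
have /= dR := tdiff_pure (p := bidegR p) u (cdiff B _ v).
rewrite linearD linearZ /= dL dR !cdiff_sqE.
rewrite /tpure !linear0 mul0mx !linear0 addr0 add0r -!/(tpure _ _).
rewrite exprS mulN1r scaleNr addrC.
apply/eqP; rewrite subr_eq0; apply/eqP; congr (_ *: _).
by congr (fun_of_lfun _ _); apply: tinj_irr.
Qed.

Definition tensor_complex : cochain_complex F := CochainComplex tdiff_sq.

End TensorComplex.

Definition deRham (F : fieldType) (G H : sgraph) : cochain_complex F :=
  tensor_complex (whitney F G) (whitney F H).

(* Main.v *)
Require Import Defs.
From HB Require Import structures.
From mathcomp Require Import all_boot all_fingroup all_algebra reals.
From mathcomp Require Import zify.
Set Implicit Arguments.
Unset Strict Implicit.
Unset Printing Implicit Defensive.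

Import GRing.Theory VectorInternalTheory.
Local Open Scope ring_scope.

(* Acyclic carriers, in dual form. A cell of either complex is carried by a pair
   of simplices (x, y): the cell x * y of the tensor complex by (x, y) itself,
   a simplex of G x H, which is a chain of such pairs, by its largest element.
   The cells carried below (x, y) form an acyclic complex: on the tensor side it
   is the product of two full simplices, on the other side a cone with apex
   (x, y). Extending degree by degree with the contractions, there is a
   chain map between two complexes carried over the same preorder, and any two
   carried chain maps that preserve the unit are homotopic; hence all such
   complexes are homotopy equivalent. *)

(** * Cochain complexes carried by a finite preorder *)

(* [cQ p] restricts a cochain to the cells with carrier exactly p; [cpi p]
   evaluates a 0-cochain at a base point below p; [ch p] is a contraction onto
   that base point, which is only required to be one on the cells carried
   below p. *)
Record carried (F : fieldType) (X : finType) (le : rel X)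
    (A : cochain_complex F) := Carried {
  cQ : X -> forall k, 'End(A k);
  cunit : A 0%N;
  cpi : X -> 'Hom(A 0%N, F^o);
  ch : X -> forall k, 'Hom(A k.+1, A k);
  cQ_sum : forall k (u : A k), \sum_p cQ p k u = u;
  cQ_orth : forall p q k (u : A k),
    cQ p k (cQ q k u) = if p == q then cQ p k u else 0;
  cdiff_local : forall p q k (u : A k),
    ~~ le q p -> cQ p k.+1 (cdiff A k (cQ q k u)) = 0;
  cdiff_unit : cdiff A 0 cunit = 0;
  cpi_unit : forall p, cpi p cunit = 1;
  cpi_local : forall p q u, ~~ le q p -> cpi p (cQ q 0%N u) = 0;
  ch_local : forall p q r k (u : A k.+1), le q p -> ~~ le r p ->
    cQ q k (ch p k (cQ r k.+1 u)) = 0;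
  ch_diff0 : forall p q (u : A 0%N), le q p ->
    cQ q 0%N (ch p 0%N (cdiff A 0 u)) = cQ q 0%N u - cpi p u *: cQ q 0%N cunit;
  ch_diffS : forall p q k (u : A k.+1), le q p ->
    cQ q k.+1 (cdiff A k (ch p k u)) + cQ q k.+1 (ch p k.+1 (cdiff A k.+1 u))
    = cQ q k.+1 u }.
Arguments cQ {F X le A} c p k.
Arguments cunit {F X le A} c.
Arguments cpi {F X le A} c p.
Arguments ch {F X le A} c p k.
Arguments cdiff_unit {F X le A} c.
Arguments cpi_unit {F X le A} c p.

Section LfunLinear.
Variables (F : fieldType) (U V : vectType F) (f : 'Hom(U, V)).

Lemma lfunD u v : f (u + v) = f u + f v. Proof. exact: linearD. Qed.
Lemma lfunB u v : f (u - v) = f u - f v. Proof. exact: linearB. Qed.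
Lemma lfunZ a u : f (a *: u) = a *: f u. Proof. exact: linearZ. Qed.

End LfunLinear.

Section RankOne.
Variables (F : fieldType) (U V : vectType F) (g : 'Hom(U, F^o)) (v : V).

Definition rank_one_fun u : V := (g u : F) *: v.

Fact rank_one_is_linear : linear rank_one_fun.
Proof.
by move=> a u w; rewrite /rank_one_fun linearP scalerDl -scalerA.
Qed.
HB.instance Definition _ :=
  GRing.isLinear.Build F _ _ _ rank_one_fun rank_one_is_linear.

Definition rank_one : 'Hom(U, V) := linfun rank_one_fun.

Lemma rank_oneE u : rank_one u = (g u : F) *: v.
Proof. exact: lfunE. Qed.

End RankOne.

Section Carriers.
Variables (F : fieldType) (X : finType) (le : rel X).
Hypotheses (le_refl : reflexive le) (le_trans : transitive le).
Implicit Types (A B C : cochain_complex F).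

Lemma cmapE A B (f : chain_map A B) k (u : A k) :
  cdiff B k (f k u) = f k.+1 (cdiff A k u).
Proof. by rewrite -!comp_lfunE cmap_comm. Qed.

(** * Gluing and locality of maps between carried complexes *)

Section Glue.
Variables (A : cochain_complex F) (V : vectType F) (cA : carried le A).
Variable k : nat.

(** Patches together maps that depend on the carrier: on the cells with carrier [p] only [M p] is
    used. This is how a contraction available for a single [p] at a time enters a global map. *)
Definition glue (M : X -> 'Hom(V, A k)) : 'Hom(V, A k) :=
  (\sum_p (cQ cA p k \o M p))%VF.

Lemma glueE M p u : cQ cA p k (glue M u) = cQ cA p k (M p u).
Proof.
rewrite sum_lfunE linear_sum (bigD1 p) //= big1 => [|q qp].
  by rewrite addr0 comp_lfunE cQ_orth eqxx.
by rewrite comp_lfunE cQ_orth eq_sym (negPf qp).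
Qed.

Lemma cQ_ext (u v : A k) : (forall p, cQ cA p k u = cQ cA p k v) -> u = v.
Proof.
move=> eq_uv; rewrite -[u](cQ_sum cA) -[v](cQ_sum cA).
by apply: eq_bigr => p _; apply: eq_uv.
Qed.

End Glue.

(** Dual form of being carried: the transpose sends a cell with carrier [p] to a combination of
    cells with carriers below [p]. *)
Definition local A B (cA : carried le A) (cB : carried le B) k l
    (M : 'Hom(A k, B l)) :=
  forall p q u, ~~ le q p -> cQ cB p l (M (cQ cA q k u)) = 0.

(** Split both cochains by carrier: the pieces not below [p] are killed by locality. Thus identities
    valid only below [p], such as those of the contraction [ch], may be used under a local map. *)
Lemma local_eq A B (cA : carried le A) (cB : carried le B) k l
    (M : 'Hom(A k, B l)) p (u v : A k) :
  local cA cB M ->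
  (forall q, le q p -> cQ cA q k u = cQ cA q k v) ->
  cQ cB p l (M u) = cQ cB p l (M v).
Proof.
move=> M_loc eq_uv; rewrite -[u](cQ_sum cA) -[v](cQ_sum cA) !linear_sum.
apply: eq_bigr => q _; have [/eq_uv->//|npq] := boolP (le q p).
by rewrite /= !M_loc.
Qed.

Section Local.
Variables (A B C : cochain_complex F).
Variables (cA : carried le A) (cB : carried le B) (cC : carried le C).

Lemma local_diff k : local cA cA (cdiff A k).
Proof. by move=> p q u; apply: cdiff_local. Qed.

Lemma local_id k : local cA cA (\1 : 'End(A k))%VF.
Proof.
move=> p q u npq; rewrite id_lfunE cQ_orth; case: eqP npq => // ->.
by rewrite le_refl.
Qed.

Lemma local_comp k l m (M : 'Hom(B l, C m)) (N : 'Hom(A k, B l)) :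
  local cB cC M -> local cA cB N -> local cA cC (M \o N)%VF.
Proof.
move=> M_loc N_loc p q u npq; rewrite comp_lfunE.
(* Comparing with the zero cochain reduces the claim to the vanishing of [N] at each [r] below [p];
   such an [r] is not above [q], by transitivity. *)
rewrite (local_eq (v := 0) M_loc) ?linear0 // => r rp.
rewrite linear0 N_loc //; apply: contra npq => qr; exact: le_trans rp.
Qed.

Lemma local_sub k l (M N : 'Hom(A k, B l)) :
  local cA cB M -> local cA cB N -> local cA cB (M - N).
Proof.
move=> M_loc N_loc p q u npq.
by rewrite add_lfunE opp_lfunE lfunB M_loc // N_loc // subrr.
Qed.

(** A contraction [ch cA p] need not be local, but at carrier [p] the glued map reads it only on
    cells below [p], where [ch_local] applies. *)
Lemma local_glue_ch k l (M : 'Hom(A k, B l)) : local cA cB M ->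
  local cA cB (glue cB (fun p => (M \o ch cA p k)%VF)).
Proof.
move=> M_loc p q u npq; rewrite glueE comp_lfunE.
rewrite (local_eq (v := 0) M_loc) ?linear0 // => r rp.
by rewrite linear0 (ch_local cA).
Qed.

End Local.

(** * Existence of a carried chain map preserving the unit *)

Section Existence.
Variables (A B : cochain_complex F) (cA : carried le A) (cB : carried le B).

(** Transpose of the usual extension over a cell with carrier [p]: take the boundary, map it by the
    previous degree, then fill it with the contraction belonging to [p]. *)
Fixpoint carrier_map k : 'Hom(A k, B k) :=
  if k is l.+1 then
    glue cB (fun p => ((cdiff B l \o carrier_map l) \o ch cA p l)%VF)
  else glue cB (fun p => rank_one (cpi cA p) (cunit cB)).

Lemma carrier_map0E p u :
  cQ cB p 0%N (carrier_map 0 u) = cpi cA p u *: cQ cB p 0%N (cunit cB).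
Proof. by rewrite glueE rank_oneE lfunZ. Qed.

Lemma carrier_map_local k : local cA cB (carrier_map k).
Proof.
elim: k => [|k IHk].
  by move=> p q u npq; rewrite carrier_map0E (cpi_local cA) // scale0r.
apply: local_glue_ch; apply: local_comp IHk; exact: local_diff.
Qed.

Lemma carrier_map_unit : carrier_map 0 (cunit cA) = cunit cB.
Proof.
by apply: (@cQ_ext _ cB) => p; rewrite carrier_map0E cpi_unit scale1r.
Qed.

(** Below [p] a cochain [u] equals [d h u + h d u], with [h d u + pi(u) 1] in degree 0. The map [d]
    after [carrier_map] is local, so [u] may be replaced by this sum. The first term (in degree 0,
    the unit term) dies, and [d carrier_map h d u] is the defining formula of [carrier_map (d u)] at
    [p]. *)
Lemma carrier_map_comm k :
  (cdiff B k \o carrier_map k = carrier_map k.+1 \o cdiff A k)%VF.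
Proof.
have loc l : local cA cB (cdiff B l \o carrier_map l)%VF.
  by apply: local_comp (@carrier_map_local l); apply: local_diff.
elim: k => [|k IHk]; apply/lfunP=> u; apply: (@cQ_ext _ cB) => p.
  transitivity (cQ cB p 1%N ((cdiff B 0 \o carrier_map 0)%VF
      (ch cA p 0 (cdiff A 0 u) + (cpi cA p u : F) *: cunit cA))).
    apply: local_eq (loc 0%N) _ => q qp.
    by rewrite lfunD ch_diff0 // lfunZ subrK.
  rewrite lfunD lfunZ [X in _ *: X]comp_lfunE carrier_map_unit cdiff_unit.
  by rewrite scaler0 addr0 [in RHS]comp_lfunE glueE [in RHS]comp_lfunE.
transitivity (cQ cB p k.+2 ((cdiff B k.+1 \o carrier_map k.+1)%VF
    (cdiff A k (ch cA p k u) + ch cA p k.+1 (cdiff A k.+1 u)))).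
  by apply: local_eq (loc k.+1) _ => q qp; rewrite lfunD ch_diffS.
(* By induction the term in [d h u] becomes [d d (carrier_map (h u))], which is zero. *)
rewrite lfunD [X in X + _]comp_lfunE -[carrier_map k.+1 _]comp_lfunE -IHk.
rewrite comp_lfunE cdiff_sqE add0r.
by rewrite [in RHS]comp_lfunE glueE [in RHS]comp_lfunE.
Qed.

Definition carrier_chain_map : chain_map A B := ChainMap carrier_map_comm.

(** * Uniqueness of carried chain maps up to homotopy *)

Section Uniqueness.
Variables f g : chain_map A B.
Hypotheses (f_loc : forall k, local cA cB (f k)).
Hypotheses (g_loc : forall k, local cA cB (g k)).
Hypothesis fg_unit : f 0%N (cunit cA) = g 0%N (cunit cA).

(** The equation to solve is [theta_k d = f_k - g_k - d theta_(k-1)]. Its right-hand side vanishes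
    on coboundaries, so composing it with the contraction at each [p] gives a solution. *)
Fixpoint carrier_htpy k : 'Hom(A k.+1, B k) :=
  glue cB (fun p =>
    ((if k is l.+1 then f l.+1 - g l.+1 - (cdiff B l \o carrier_htpy l)%VF
      else f 0%N - g 0%N) \o ch cA p k)%VF).

Lemma carrier_htpy_local k : local cA cB (carrier_htpy k).
Proof.
elim: k => [|k IHk]; apply: local_glue_ch; first exact: local_sub.
apply: local_sub; first exact: local_sub.
by apply: local_comp IHk; apply: local_diff.
Qed.

Lemma carrier_htpy0 : f 0%N - g 0%N = (carrier_htpy 0 \o cdiff A 0)%VF.
Proof.
apply/lfunP=> u; apply: (@cQ_ext _ cB) => p.
transitivity (cQ cB p 0%N ((f 0%N - g 0%N)
    (ch cA p 0 (cdiff A 0 u) + (cpi cA p u : F) *: cunit cA))).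
  apply: local_eq (local_sub (@f_loc _) (@g_loc _)) _ => q qp.
  by rewrite lfunD ch_diff0 // lfunZ subrK.
rewrite lfunD lfunZ [X in _ *: X]add_lfunE opp_lfunE fg_unit subrr.
(* Agreement on the unit has removed the base-point term; what is left is the definition of the
   homotopy at [p]. *)
by rewrite scaler0 addr0 [in RHS]comp_lfunE glueE [in RHS]comp_lfunE.
Qed.

(** The premise is the homotopy relation in degree [k] after applying [d]. In this form it covers
    both degree 0 and positive degrees, where the additional summand [d theta] is killed by
    [d d = 0]. *)
Lemma carrier_htpy_step k :
  (forall u, cdiff B k ((f k - g k) u) =
    cdiff B k (carrier_htpy k (cdiff A k u))) ->
  f k.+1 - g k.+1 - (cdiff B k \o carrier_htpy k)%VF =
    (carrier_htpy k.+1 \o cdiff A k.+1)%VF.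
Proof.
move=> d2; set N := _ - _ - _.
have N_loc : local cA cB N.
  apply: local_sub; first exact: local_sub.
  by apply: local_comp (@carrier_htpy_local k); apply: local_diff.
(* Since [f] and [g] commute with [d], this is exactly the premise; hence only [h d u] survives
   below. *)
have Nd u : N (cdiff A k u) = 0.
  rewrite /N 2!add_lfunE !opp_lfunE -!cmapE comp_lfunE -d2.
  by rewrite add_lfunE opp_lfunE lfunB subrr.
apply/lfunP=> u; apply: (@cQ_ext _ cB) => p.
transitivity (cQ cB p k.+1 (N
    (cdiff A k (ch cA p k u) + ch cA p k.+1 (cdiff A k.+1 u)))).
  by apply: local_eq N_loc _ => q qp; rewrite lfunD ch_diffS.
by rewrite lfunD Nd add0r [in RHS]comp_lfunE glueE [in RHS]comp_lfunE.
Qed.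

Lemma carrier_htpyS k : f k.+1 - g k.+1 =
  (cdiff B k \o carrier_htpy k)%VF + (carrier_htpy k.+1 \o cdiff A k.+1)%VF.
Proof.
elim: k => [|k IHk]; apply/eqP; rewrite [X in _ == X]addrC -subr_eq; apply/eqP;
  apply: carrier_htpy_step => u.
  by rewrite carrier_htpy0 comp_lfunE.
by rewrite IHk add_lfunE lfunD !comp_lfunE cdiff_sqE add0r.
Qed.

Lemma carrier_homotopic : chain_homotopic f g.
Proof.
by exists carrier_htpy; split; [apply: carrier_htpy0 | apply: carrier_htpyS].
Qed.

End Uniqueness.
End Existence.

(** Each composite of the two carrier maps is local and preserves the unit, as does the identity, so
    uniqueness up to homotopy identifies them. *)
Lemma carried_equivalence A B (cA : carried le A) (cB : carried le B) :
  exists (psi : chain_map A B) (phi : chain_map B A),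
    chain_homotopic (chain_comp phi psi) (chain_id A) /\
    chain_homotopic (chain_comp psi phi) (chain_id B).
Proof.
have comp_id C D (cC : carried le C) (cD : carried le D) :
    chain_homotopic (chain_comp (carrier_chain_map cD cC)
      (carrier_chain_map cC cD)) (chain_id C).
  apply: (@carrier_homotopic _ _ cC cC) => [k|k|].
  - by apply: local_comp (@carrier_map_local _ _ cD cC k)
      (@carrier_map_local _ _ cC cD k).
  - exact: local_id.
  - by rewrite /= comp_lfunE !carrier_map_unit id_lfunE.
by exists (carrier_chain_map cA cB), (carrier_chain_map cB cA).
Qed.

End Carriers.

(** * The tensor product of carried complexes *)

Section TensorPure.
Variables (F : fieldType) (U V : vectType F).
Implicit Types (u : U) (v : V).

Lemma tpureDl u u' v : tpure (u + u') v = tpure u v + tpure u' v.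
Proof. by have [] := tensor_bilinear 1 u u' v v; rewrite !scale1r. Qed.
Lemma tpureDr u v v' : tpure u (v + v') = tpure u v + tpure u v'.
Proof. by have [_] := tensor_bilinear 1 u u v v'; rewrite !scale1r. Qed.
Lemma tpure0l v : tpure (0 : U) v = 0.
Proof. by rewrite /tpure !linear0 mul0mx. Qed.
Lemma tpure0r u : tpure u (0 : V) = 0.
Proof. by rewrite /tpure !linear0. Qed.
Lemma tpureZl a u v : tpure (a *: u) v = a *: tpure u v.
Proof. by have [] := tensor_bilinear a u 0 v v; rewrite tpure0l !addr0. Qed.
Lemma tpureZr a u v : tpure u (a *: v) = a *: tpure u v.
Proof. by have [_] := tensor_bilinear a u u v 0; rewrite tpure0r !addr0. Qed.
Lemma tpureBl u u' v : tpure (u - u') v = tpure u v - tpure u' v.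
Proof. by rewrite tpureDl -scaleN1r tpureZl scaleN1r. Qed.
Lemma tpureBr u v v' : tpure u (v - v') = tpure u v - tpure u v'.
Proof. by rewrite tpureDr -scaleN1r tpureZr scaleN1r. Qed.
Lemma tpure_suml (I : finType) (u : I -> U) v :
  tpure (\sum_i u i) v = \sum_i tpure (u i) v.
Proof. by rewrite /tpure !linear_sum mulmx_suml. Qed.
Lemma tpure_sumr (I : finType) u (v : I -> V) :
  tpure u (\sum_i v i) = \sum_i tpure u (v i).
Proof. by rewrite /tpure !linear_sum. Qed.

Variables (f : 'Hom(U, F^o)) (g : 'Hom(V, F^o)).

(** The functional [f (x) g], written in the coordinates that define [tensor] so that its values lie
    in [F] itself rather than in a tensor square. *)
Definition tform_fun (t : tensor U V) : F^o :=
  \sum_i \sum_j (t : 'M[F]_(dim U, dim V)) i j *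
    ((f (r2v (delta_mx 0 i)) : F) * (g (r2v (delta_mx 0 j)) : F)).

Fact tform_is_linear : linear tform_fun.
Proof.
move=> a s t; rewrite /tform_fun scaler_sumr -big_split; apply: eq_bigr => i _.
rewrite scaler_sumr -big_split; apply: eq_bigr => j _ /=.
by rewrite !mxE mulrDl -mulrA.
Qed.
HB.instance Definition _ :=
  GRing.isLinear.Build F _ _ _ tform_fun tform_is_linear.

Definition tform : 'Hom(tensor U V, F^o) := linfun tform_fun.

Lemma tformE u v : tform (tpure u v) = (f u : F) * (g v : F).
Proof.
rewrite lfunE /= /tform_fun -{2}[u]v2rK [v2r u in RHS]row_sum_delta.
rewrite -{2}[v]v2rK [v2r v in RHS]row_sum_delta !linear_sum mulr_suml.
apply: eq_bigr => i _; rewrite mulr_sumr; apply: eq_bigr => j _.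
rewrite !linearZ /= mxE big_ord1 mxE.
exact: mulrACA.
Qed.

End TensorPure.

(** * Summands of the total complex *)

Section TotalDegree.
Variables (F : fieldType) (A B : cochain_complex F).

Fact tin_ltl k i j : (i + j == k -> i < k.+1)%N.
Proof. by move/eqP<-; rewrite ltnS leq_addr. Qed.
Fact tin_ltr k i j : (i + j == k -> j < k.+1)%N.
Proof. by move/eqP<-; rewrite ltnS leq_addl. Qed.

(** Summands are indexed by natural numbers with a proof on their sum, instead of by ordinals, so
    that two inclusions with the same degrees differ only by a boolean proof ([tin_irr]). *)
Definition tin k i j (ijk : (i + j == k)%N) :
    'Hom(tensor (A i) (B j), tspace A B k) :=
  tinj A B (exist _ (Ordinal (tin_ltl ijk), Ordinal (tin_ltr ijk)) ijk
    : bideg k).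

Lemma tinjE k (p : bideg k) : tinj A B p = tin (valP p).
Proof. by case: p => [[[i hi] [j hj]] h]; apply: tinj_irr. Qed.

Lemma tin_irr k i j (h h' : (i + j == k)%N) : tin h = tin h'.
Proof. by rewrite (bool_irrelevance h h'). Qed.

(** Pure tensors in the summands generate additively, since scalars are absorbed into the left
    factor; linear identities are checked on them below. *)
Lemma tspace_ind k (P : tspace A B k -> Prop) :
    P 0 -> (forall s t, P s -> P t -> P (s + t)) ->
    (forall i j (ijk : (i + j == k)%N) u v, P (tin ijk (tpure u v))) ->
  forall t, P t.
Proof.
move=> P0 PD Ptin t.
have -> : t = \sum_p tinj A B p (tproj A B p t).
  rewrite -[LHS]id_lfunE -(dsum_sum (fun p : bideg k => _)) sum_lfunE.
  by apply: eq_bigr => p _; rewrite comp_lfunE.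
apply: (big_ind P) => // p _; rewrite tinjE.
set s := tproj _ _ _ _; rewrite [s]tensor_delta linear_sum.
apply: (big_ind P) => // i _; rewrite linear_sum; apply: (big_ind P) => // j _.
by rewrite -tpureZl; apply: Ptin.
Qed.

Lemma tdiff_tin k i j (ijk : (i + j == k)%N) (hL : (i.+1 + j == k.+1)%N)
    (hR : (i + j.+1 == k.+1)%N) (u : A i) (v : B j) :
  tdiff A B k (tin ijk (tpure u v)) =
    tin hL (tpure (cdiff A i u) v)
    + (-1) ^+ i *: tin hR (tpure u (cdiff B j v)).
Proof.
pose p : bideg k := exist _ (Ordinal (tin_ltl ijk), Ordinal (tin_ltr ijk)) ijk.
rewrite -[LHS]/(tdiff A B k (tinj A B p (tpure (u : A (val p).1) v))).
rewrite tdiff_pure; congr (_ + _ *: _).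
  by congr (fun_of_lfun _ _); apply: tinj_irr.
by congr (fun_of_lfun _ _); apply: tinj_irr.
Qed.

Section Lift.
Variables (W : vectType F) (k : nat).
Variable M : forall i j, (i + j == k)%N -> 'Hom(tensor (A i) (B j), W).

Definition tlift : 'Hom(tspace A B k, W) :=
  \sum_(p : bideg k) (M (valP p) \o tproj A B p)%VF.

Lemma tlift_inj (p : bideg k) : (tlift \o tinj A B p)%VF = M (valP p).
Proof.
apply/lfunP=> t; rewrite comp_lfunE sum_lfunE (bigD1 p) //= big1 => [|q qp].
  by rewrite addr0 -comp_lfunE -comp_lfunA dinjK comp_lfun1r.
by rewrite -comp_lfunE -comp_lfunA dinj_neq 1?eq_sym // comp_lfun0r zero_lfunE.
Qed.

Lemma tliftE i j (ijk : (i + j == k)%N) t : tlift (tin ijk t) = M ijk t.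
Proof.
pose p : bideg k := exist _ (Ordinal (tin_ltl ijk), Ordinal (tin_ltr ijk)) ijk.
have /lfunP/(_ t) := tlift_inj p; rewrite comp_lfunE => ->.
by rewrite (bool_irrelevance (valP p) ijk).
Qed.

End Lift.
End TotalDegree.
Arguments tin {F A B k i j} ijk.
Arguments tlift {F A B W k} M.
Arguments tin_irr {F A B k i j} h h'.

(** * Carrier structure on the tensor product *)

Section CarriedTensor.
Variables (F : fieldType) (X Y : finType) (leX : rel X) (leY : rel Y).
Hypotheses (leX_refl : reflexive leX) (leY_refl : reflexive leY).
Variables (A B : cochain_complex F) (cA : carried leX A) (cB : carried leY B).

Definition prod_le : rel (X * Y) :=
  fun p q => leX p.1 q.1 && leY p.2 q.2.

Implicit Types p q r : X * Y.

Definition tQ p k : 'End(tspace A B k) :=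
  tlift (fun i j (ijk : (i + j == k)%N) =>
    tin ijk \o thom (cQ cA p.1 i) (cQ cB p.2 j))%VF.

Definition tunit : tspace A B 0 :=
  tin (eqxx 0 : 0 + 0 == 0)%N (tpure (cunit cA) (cunit cB)).

(** Evaluation at the pair of base points. In total degree 0 only [i = j = 0] can occur; the value 0
    elsewhere is a filler. *)
Definition tpi p : 'Hom(tspace A B 0, F^o) :=
  tlift (fun i j => match i, j return
      (i + j == 0)%N -> 'Hom(tensor (A i) (B j), F^o) with
    | 0, 0 => fun=> tform (cpi cA p.1) (cpi cB p.2)
    | _, _ => fun=> 0%R
    end%N).

(* The contraction h (x) 1 + e (x) h, where e is the projection onto the unit,
   which is 0 in positive degrees. *)
Definition th p k : 'Hom(tspace A B k.+1, tspace A B k) :=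
  tlift (fun i j => match i, j return
      (i + j == k.+1)%N -> 'Hom(tensor (A i) (B j), tspace A B k) with
    | i'.+1, _ => fun ijk =>
       (tin (ijk : (i' + _ == k)%N) \o thom (ch cA p.1 i') \1)%VF
    | 0, j'.+1 => fun ijk =>
       (tin (ijk : (0 + j' == k)%N) \o
          thom (rank_one (cpi cA p.1) (cunit cA)) (ch cB p.2 j'))%VF
    | 0, 0 => fun=> 0%R
    end%N).

Lemma tQ_tin p k i j (h : (i + j == k)%N) u v :
  tQ p k (tin h (tpure u v)) = tin h (tpure (cQ cA p.1 i u) (cQ cB p.2 j v)).
Proof. by rewrite tliftE comp_lfunE thomE. Qed.

Lemma tpi_tin p h (u : A 0%N) (v : B 0%N) :
  tpi p (tin h (tpure u v)) = (cpi cA p.1 u : F) * cpi cB p.2 v.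
Proof. by rewrite tliftE tformE. Qed.

Lemma th_tinS p k i j (h : (i.+1 + j == k.+1)%N) (h' : (i + j == k)%N) u v :
  th p k (tin h (tpure u v)) = tin h' (tpure (ch cA p.1 i u) v).
Proof. by rewrite tliftE comp_lfunE thomE id_lfunE (tin_irr _ h'). Qed.

Lemma th_tin0 p k j (h : (0 + j.+1 == k.+1)%N) (h' : (0 + j == k)%N) u v :
  th p k (tin h (tpure u v)) =
    (cpi cA p.1 u : F) *: tin h' (tpure (cunit cA) (ch cB p.2 j v)).
Proof.
by rewrite tliftE comp_lfunE thomE rank_oneE tpureZl lfunZ (tin_irr _ h').
Qed.

Lemma cQ_neq (Z : finType) (leZ : rel Z) (C : cochain_complex F)
    (cC : carried leZ C) (p q : Z) k (u : C k) :
  reflexive leZ -> ~~ leZ q p -> cQ cC p k (cQ cC q k u) = 0.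
Proof.
by move=> rf npq; rewrite cQ_orth; case: eqP npq => // ->; rewrite rf.
Qed.

Lemma tin0l k i j (h : (i + j == k)%N) (u : A i) (v : B j) :
  u = 0 -> tin h (tpure u v) = 0.
Proof. by move->; rewrite tpure0l linear0. Qed.

Lemma tin0r k i j (h : (i + j == k)%N) (u : A i) (v : B j) :
  v = 0 -> tin h (tpure u v) = 0.
Proof. by move->; rewrite tpure0r linear0. Qed.

Lemma tQ_sum k u : \sum_p tQ p k u = u.
Proof.
elim/tspace_ind: u => [|s t IHs IHt|i j h u v].
- by rewrite big1 // => p _; rewrite linear0.
- rewrite -{2}IHs -{2}IHt -big_split; apply: eq_bigr => p _; exact: lfunD.
- rewrite -{2}(cQ_sum cA u) -{2}(cQ_sum cB v) tpure_suml linear_sum.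
  rewrite (eq_bigr (fun p => tin h (tpure (cQ cA p.1 i u) (cQ cB p.2 j v)))).
    rewrite -(pair_bigA _
      (fun x y => tin h (tpure (cQ cA x i u) (cQ cB y j v)))).
    by apply: eq_bigr => x _; rewrite /= tpure_sumr linear_sum.
  by move=> p _; rewrite tQ_tin.
Qed.

Lemma tQ_orth p q k u : tQ p k (tQ q k u) = if p == q then tQ p k u else 0.
Proof.
elim/tspace_ind: u => [|s t IHs IHt|i j h u v].
- by rewrite !linear0 if_same.
- by rewrite !lfunD IHs IHt; case: ifP; rewrite ?addr0.
rewrite !tQ_tin !cQ_orth.
case: p q => [x y] [x' y'] /=; rewrite xpair_eqE.
case: ifP => _ /=; last by rewrite tin0l.
by case: ifP => _ //; rewrite tin0r.
Qed.

(** In the factor where the comparison of [q] with [p] fails, one term of [d] vanishes by locality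
    of the differential and the other by orthogonality of the restrictions. *)
Lemma tdiff_local p q k u :
  ~~ prod_le q p -> tQ p k.+1 (tdiff A B k (tQ q k u)) = 0.
Proof.
move=> npq; elim/tspace_ind: u => [|s t IHs IHt|i j h u v].
- by rewrite !linear0.
- by rewrite !lfunD IHs IHt addr0.
have hL : (i.+1 + j == k.+1)%N by [].
have hR : (i + j.+1 == k.+1)%N by rewrite addnS.
rewrite tQ_tin (tdiff_tin _ hL hR) lfunD lfunZ !tQ_tin.
case/nandP: npq => npq.
  by rewrite !tin0l ?scaler0 ?addr0 // ?cdiff_local // cQ_neq.
by rewrite !tin0r ?scaler0 ?addr0 // ?cdiff_local // cQ_neq.
Qed.

Lemma tdiff_unit : tdiff A B 0 tunit = 0.
Proof.
rewrite (tdiff_tin _ (eqxx _ : 1 + 0 == 1)%N (eqxx _ : 0 + 1 == 1)%N).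
by rewrite tin0l ?cdiff_unit // tin0r ?cdiff_unit // scaler0 addr0.
Qed.

Lemma tpi_unit p : tpi p tunit = 1.
Proof. by rewrite tpi_tin !cpi_unit mulr1. Qed.

Lemma tpi_local p q u : ~~ prod_le q p -> tpi p (tQ q 0%N u) = 0.
Proof.
move=> npq; elim/tspace_ind: u => [|s t IHs IHt|i j h u v].
- by rewrite !linear0.
- by rewrite !lfunD IHs IHt addr0.
case: i j h u v => [|i] [|j] // h u v; rewrite tQ_tin tpi_tin.
case/nandP: npq => npq; first by rewrite (cpi_local cA) // mul0r.
by rewrite (cpi_local cB) // mulr0.
Qed.

Lemma th_local p q r k u : prod_le q p -> ~~ prod_le r p ->
  tQ q k (th p k (tQ r k.+1 u)) = 0.
Proof.
move=> /andP[qp1 qp2] nrp.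
(* Needed when the contraction acts on the first factor only: [q.2] is below [p.2] and [r.2] is not,
   so they differ. *)
have neq2 l (v : B l) : ~~ leY r.2 p.2 -> cQ cB q.2 l (cQ cB r.2 l v) = 0.
  by move=> nrp2; rewrite cQ_orth; case: eqP nrp2 => // <-; rewrite qp2.
elim/tspace_ind: u => [|s t IHs IHt|i j h u v].
- by rewrite !linear0.
- by rewrite !lfunD IHs IHt addr0.
case: i j h u v => [|i] [|j] // h u v; rewrite tQ_tin.
- rewrite th_tin0 lfunZ tQ_tin; case/nandP: nrp => nrp.
    by rewrite cpi_local // scale0r.
  by rewrite tin0r ?scaler0 // (ch_local cB).
all: rewrite th_tinS tQ_tin; case/nandP: nrp => nrp.
1,3: by rewrite tin0l // (ch_local cA).
all: by rewrite tin0r // neq2.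
Qed.

(** The two terms [(u - pi(u) 1) (x) v] and [pi(u) 1 (x) (v - pi(v) 1)] telescope. *)
Lemma th_diff0 p q u : prod_le q p ->
  tQ q 0%N (th p 0%N (tdiff A B 0 u)) = tQ q 0%N u - tpi p u *: tQ q 0%N tunit.
Proof.
move=> /andP[qp1 qp2]; elim/tspace_ind: u => [|s t IHs IHt|i j h u v].
- by rewrite !linear0 scale0r subrr.
- by rewrite !lfunD IHs IHt scalerDl opprD addrACA.
case: i j h u v => [|i] [|j] // h u v.
rewrite (tdiff_tin _ (eqxx _ : 1 + 0 == 1)%N (eqxx _ : 0 + 1 == 1)%N).
rewrite expr0 scale1r lfunD (th_tinS _ _ h) (th_tin0 _ _ h) lfunD lfunZ.
rewrite !tQ_tin tpi_tin (ch_diff0 cA) // (ch_diff0 cB) // (tin_irr _ h).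
rewrite tpureBl tpureBr !tpureZl !tpureZr !lfunB !lfunZ scalerBr scalerA.
by rewrite addrA subrK.
Qed.

Lemma th_diffS p q k u : prod_le q p ->
  tQ q k.+1 (tdiff A B k (th p k u)) +
    tQ q k.+1 (th p k.+1 (tdiff A B k.+1 u)) = tQ q k.+1 u.
Proof.
move=> /andP[qp1 qp2]; elim/tspace_ind: u => [|s t IHs IHt|i j h u v].
- by rewrite !linear0 addr0.
- by rewrite !lfunD addrACA IHs IHt.
have hL : (i.+1 + j == k.+2)%N by [].
have hR : (i + j.+1 == k.+2)%N by rewrite addnS.
rewrite (tdiff_tin _ hL hR) lfunD lfunZ (th_tinS _ _ h).
case: i h u hL hR => [|i] h u hL hR.
  (* First degree 0: [d 1 = 0] leaves [(h d u) (x) v + pi(u) 1 (x) (d h + h d) v], and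
     [h d u = u - pi(u) 1] below [p]. *)
  rewrite expr0 scale1r (th_tin0 _ _ h).
  case: j h v hL hR => [|j] // h v hL hR.
  have h' : (0 + j == k)%N by [].
  have hL' : (1 + j == k.+1)%N by [].
  rewrite (th_tin0 _ _ h') lfunZ (tdiff_tin _ hL' h) tin0l ?cdiff_unit //.
  rewrite add0r expr0 scale1r lfunD !lfunZ !tQ_tin addrCA -scalerDr -lfunD.
  rewrite -tpureDr ch_diffS // ch_diff0 // tpureBl tpureZl lfunB lfunZ.
  by rewrite subrK.
(* First degree positive: the two terms in [h u (x) d v] carry opposite signs and cancel, leaving
   [(d h + h d) u (x) v]. *)
have h' : (i + j == k)%N by [].
have hR' : (i + j.+1 == k.+1)%N by rewrite addnS.
rewrite (th_tinS _ h h') (tdiff_tin _ h hR') (th_tinS _ hR hR') !lfunD !lfunZ.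
rewrite !tQ_tin exprS mulN1r scaleNr -addrA (addrC _ (_ - _)) subrK -lfunD.
by rewrite -tpureDl ch_diffS.
Qed.

Definition carried_tensor : carried prod_le (tensor_complex A B) :=
  @Carried _ _ _ (tensor_complex A B) tQ tunit tpi th tQ_sum tQ_orth
    tdiff_local tdiff_unit tpi_unit tpi_local th_local th_diff0 th_diffS.

End CarriedTensor.

(** * Whitney complexes covered by cones *)

Section Extension.
Variable K : sgraph.
Implicit Types (v : K) (k : nat).

Fact osimplex_simplexP k (x : osimplex K k) :
  (osupp x != set0) && complete (osupp x).
Proof.
have /andP[_ ->] := osimplexP x; rewrite andbT.
by apply/set0Pn; exists (x ord0); apply: imset_f.
Qed.

Definition osimplex_simplex k (x : osimplex K k) : simplex K :=
  Simplex (osimplex_simplexP x).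

Lemma osimplex_simplex_operm k s (x : osimplex K k) :
  osimplex_simplex (operm s x) = osimplex_simplex x.
Proof. exact/val_inj/osupp_opermE. Qed.

Lemma osupp_oface k l (x : osimplex K k.+1) : osupp (oface l x) \subset osupp x.
Proof. by apply/subsetP=> _ /imsetP[i _ ->]; rewrite ffunE imset_f. Qed.

Fact opointP v : injectiveb [ffun _ : 'I_1 => v] &&
  complete [set [ffun _ : 'I_1 => v] i | i : 'I_1].
Proof.
apply/andP; split; first by apply/injectiveP=> i j _; rewrite !ord1.
apply/forall_inP=> _ /imsetP[i _ ->]; apply/forall_inP=> _ /imsetP[j _ ->].
by rewrite !ffunE eqxx.
Qed.

Definition opoint v : osimplex K 0 := OSimplex (opointP v).

Lemma osupp_opoint v : osupp (opoint v) = [set v].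
Proof.
apply/setP=> u; rewrite inE; apply/imsetP/eqP => [[i _ ->]|->].
  by rewrite ffunE.
by exists ord0; rewrite ?ffunE.
Qed.

Definition ocons v k (x : osimplex K k) : {ffun 'I_k.+2 -> K} :=
  [ffun i => if unlift ord0 i is Some j then x j else v].

Lemma ocons0 v k (x : osimplex K k) : ocons v x ord0 = v.
Proof. by rewrite ffunE unlift_none. Qed.

Lemma oconsS v k (x : osimplex K k) i : ocons v x (lift ord0 i) = x i.
Proof. by rewrite ffunE liftK. Qed.

Lemma ocons_im v k (x : osimplex K k) :
  [set ocons v x i | i : 'I_k.+2] = v |: osupp x.
Proof.
apply/setP=> u; rewrite in_setU1; apply/imsetP/predU1P.
  move=> [i _ ->]; case: (unliftP ord0 i) => [j|] ->.
    by right; rewrite oconsS imset_f.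
  by left; rewrite ocons0.
case=> [->|/imsetP[j _ ->]]; first by exists ord0; rewrite ?ocons0.
by exists (lift ord0 j); rewrite ?oconsS.
Qed.

Lemma oconsP v k (x : osimplex K k) :
  injectiveb (ocons v x) && complete [set ocons v x i | i : 'I_k.+2] =
  (v \notin osupp x) && complete (v |: osupp x).
Proof.
rewrite ocons_im; congr (_ && _).
have x_inj := injectiveP _ (proj1 (andP (osimplexP x))).
apply/injectiveP/idP => [inj_vx|nvx i j].
  apply/imsetP => -[j _ def_v].
  have := inj_vx ord0 (lift ord0 j); rewrite ocons0 oconsS => /(_ def_v) /eqP.
  by rewrite (negPf (neq_lift _ _)).
case: (unliftP ord0 i) (unliftP ord0 j) => [i'|] -> [j'|] ->;
  rewrite ?oconsS ?ocons0 // => eq_ij.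
- by rewrite (x_inj _ _ eq_ij).
- by rewrite -eq_ij imset_f in nvx.
- by rewrite eq_ij imset_f in nvx.
Qed.

(** The cone over [x] with [v] as its first vertex. It is undefined both when [v] already lies in
    [x] and when [v] does not span a simplex with [x]. *)
Definition oext v k (x : osimplex K k) : option (osimplex K k.+1) :=
  insub (ocons v x).

Lemma oext_some v k (x : osimplex K k) y :
  oseq y = ocons v x -> oext v x = Some y.
Proof. by move=> def_y; rewrite /oext -def_y; apply: (valK y). Qed.

Lemma oext_val v k (x : osimplex K k) y :
  oext v x = Some y -> oseq y = ocons v x.
Proof. by rewrite /oext; case: insubP => // z _ <- [->]. Qed.

Lemma oext_none v k (x : osimplex K k) : v \in osupp x -> oext v x = None.
Proof. by move=> vx; rewrite /oext insubF // oconsP vx. Qed.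

Lemma oext_ex v k (x : osimplex K k) :
  v \notin osupp x -> complete (v |: osupp x) -> exists y, oext v x = Some y.
Proof.
move=> nvx vx; have Pvx : (v \notin osupp x) && complete (v |: osupp x).
  exact/andP.
by rewrite -oconsP in Pvx; exists (OSimplex Pvx); apply: oext_some.
Qed.

Lemma osupp_oext v k (x : osimplex K k) y :
  oext v x = Some y -> osupp y = v |: osupp x.
Proof. by move=> /oext_val def_y; rewrite /osupp def_y ocons_im. Qed.

Lemma oext_operm v k s (x : osimplex K k) :
  oext v (operm s x) = omap (operm (lift_perm ord0 ord0 s)) (oext v x).
Proof.
case vx: (oext v x) => [y|] /=.
  apply/oext_some/ffunP=> i; rewrite ffunE (oext_val vx).
  case: (unliftP ord0 i) => [j|] ->.
    by rewrite lift_perm_lift !oconsS ffunE.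
  by rewrite lift_perm_id !ocons0.
move: vx; rewrite /oext; case: insubP => // + _.
by rewrite oconsP => nvx; rewrite insubF // oconsP osupp_opermE; apply/negbTE.
Qed.

Lemma oface0_oext v k (x : osimplex K k) y :
  oext v x = Some y -> oface ord0 y = x.
Proof.
move=> /oext_val def_y; apply/val_inj/ffunP=> i.
by rewrite ffunE def_y oconsS.
Qed.

Lemma oext_oface v k l (x : osimplex K k.+1) y : oext v x = Some y ->
  oext v (oface l x) = Some (oface (lift ord0 l) y).
Proof.
move=> /oext_val def_y; apply/oext_some/ffunP=> i; rewrite ffunE def_y.
case: (unliftP ord0 i) => [j|] ->.
  have -> : lift (lift ord0 l) (lift ord0 j) = lift ord0 (lift l j).
    by apply/val_inj; rewrite /= /bump /=; lia.
  by rewrite !oconsS ffunE.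
have -> : lift (lift ord0 l) ord0 = ord0 by exact/val_inj.
by rewrite !ocons0.
Qed.

(** Deleting the vertex at place [l] and coning from it moves that vertex to the front, a cycle of
    sign [(-1)^l]. *)
Lemma oext_oface_id k l (x : osimplex K k.+1) :
  oext (x l) (oface l x) = Some (operm (lift_perm ord0 l 1) x).
Proof.
apply/oext_some/ffunP=> i; rewrite ffunE.
case: (unliftP ord0 i) => [j|] ->.
  by rewrite oconsS lift_perm_lift perm1 ffunE.
by rewrite ocons0 lift_perm_id.
Qed.

End Extension.

(** * Carrier structure on a Whitney complex *)

Section CarriedWhitney.
Variables (F : fieldType) (K : sgraph) (X : finType) (le : rel X).
(** [s] gives the carrier of a simplex. The hypotheses say that carriers grow with simplices and
    that the simplices carried below [p] form a cone with apex [apex p]. *)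
Variables (s : simplex K -> X) (apex : X -> K).
Hypothesis s_homo :
  forall S T : simplex K, simplex_set S \subset T -> le (s S) (s T).
Hypothesis s_apex :
  forall p (T : simplex K), simplex_set T = [set apex p] -> le (s T) p.
Hypothesis apex_complete :
  forall p (S : simplex K), le (s S) p -> complete (apex p |: S).
Hypothesis s_apexU : forall p (S T : simplex K),
  le (s S) p -> simplex_set T = apex p |: S -> le (s T) p.

Let so k (x : osimplex K k) := s (osimplex_simplex x).

Section FormMap.
Variables (k l : nat).
Variable f : {linear {ffun osimplex K k -> F^o} -> {ffun osimplex K l -> F^o}}.
Hypothesis f_alt : forall g, g \in altforms F K k -> f g \in altforms F K l.

Definition form_map : 'Hom(forms F K k, forms F K l) :=
  linfun (vsproj (altforms F K l) \o f \o vsval).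

Lemma form_mapE g : vsval (form_map g) = f (vsval g).
Proof. by rewrite lfunE /= vsprojK // f_alt // subvsP. Qed.

End FormMap.

Lemma forms_eq k (f g : forms F K k) :
  (forall x, vsval f x = vsval g x) -> f = g.
Proof. by move=> eq_fg; apply/val_inj/ffunP. Qed.

Definition raw_restr p k (f : {ffun osimplex K k -> F^o}) :
    {ffun osimplex K k -> F^o} :=
  [ffun x => if so x == p then f x else 0].

Fact raw_restr_is_linear p k : linear (@raw_restr p k).
Proof.
move=> a f g; apply/ffunP=> x; rewrite !ffunE.
by case: eqP => _; rewrite ?scaler0 ?addr0.
Qed.
HB.instance Definition _ p k :=
  GRing.isLinear.Build F _ _ _ (@raw_restr p k) (@raw_restr_is_linear p k).

Lemma raw_restr_alt p k (f : {ffun osimplex K k -> F^o}) :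
  f \in altforms F K k -> raw_restr p f \in altforms F K k.
Proof.
move=> /altformsP f_alt; apply/altformsP=> t x.
by rewrite !ffunE /so osimplex_simplex_operm; case: eqP; rewrite ?mulr0 ?f_alt.
Qed.

(** Transpose of the cone operator. The value 0 is the right one for a degenerate cone; for a
    missing one it is a default that never arises for carriers below [p]. *)
Definition raw_cone p k (f : {ffun osimplex K k.+1 -> F^o}) :
    {ffun osimplex K k -> F^o} :=
  [ffun x => oapp f 0 (oext (apex p) x)].

Fact raw_cone_is_linear p k : linear (@raw_cone p k).
Proof.
move=> a f g; apply/ffunP=> x; rewrite !ffunE.
by case: (oext _ _) => [y|] /=; rewrite ?ffunE // scaler0 addr0.
Qed.
HB.instance Definition _ p k :=
  GRing.isLinear.Build F _ _ _ (@raw_cone p k) (@raw_cone_is_linear p k).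

Lemma raw_cone_alt p k (f : {ffun osimplex K k.+1 -> F^o}) :
  f \in altforms F K k.+1 -> raw_cone p f \in altforms F K k.
Proof.
move=> /altformsP f_alt; apply/altformsP=> t x; rewrite !ffunE oext_operm.
case: (oext _ _) => [y|] /=; last by rewrite mulr0.
by rewrite f_alt odd_lift_perm.
Qed.

Definition wQ p k : 'End(forms F K k) := form_map (raw_restr p (k := k)).
Definition wh p k : 'Hom(forms F K k.+1, forms F K k) :=
  form_map (raw_cone p (k := k)).
Definition wunit : forms F K 0 :=
  vsproj (altforms F K 0) ([ffun=> 1] : {ffun osimplex K 0 -> F^o}).
Definition wpi_fun p (f : forms F K 0) : F^o := vsval f (opoint (apex p)).
Fact wpi_is_linear p : linear (wpi_fun p).
Proof. by move=> a f g; rewrite /wpi_fun linearP !ffunE. Qed.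
HB.instance Definition _ p :=
  GRing.isLinear.Build F _ _ _ (wpi_fun p) (wpi_is_linear p).
Definition wpi p : 'Hom(forms F K 0, F^o) := linfun (wpi_fun p).

Lemma wQE p k f x : vsval (wQ p k f) x = if so x == p then vsval f x else 0.
Proof. by rewrite form_mapE ?ffunE //; apply: raw_restr_alt. Qed.

Lemma whE p k f x :
  vsval (wh p k f) x = oapp (vsval f) 0 (oext (apex p) x).
Proof. by rewrite form_mapE ?ffunE //; apply: raw_cone_alt. Qed.

Lemma wunitE x : vsval wunit x = 1.
Proof.
rewrite vsprojK ?ffunE //; apply/altformsP=> t y; rewrite !ffunE.
have -> : t = 1%g by apply/permP=> i; rewrite !ord1.
by rewrite odd_perm1 mul1r.
Qed.

Lemma wpiE p f : wpi p f = vsval f (opoint (apex p)).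
Proof. exact: lfunE. Qed.

Lemma wQ_sum k u : \sum_p wQ p k u = u.
Proof.
apply: forms_eq => x; rewrite linear_sum sum_ffunE (bigD1 (so x)) //= wQE eqxx.
by rewrite big1 ?addr0 // => p /negPf xp; rewrite wQE eq_sym xp.
Qed.

Lemma wQ_orth p q k u : wQ p k (wQ q k u) = if p == q then wQ p k u else 0.
Proof.
apply: forms_eq => x; rewrite !wQE; have [<-|npq] := eqVneq p q.
  by rewrite wQE; case: eqP.
by case: eqP => [->|_]; rewrite ?(negPf npq) ffunE.
Qed.

Lemma wdiff_local p q k u :
  ~~ le q p -> wQ p k.+1 (extdiff F K k (wQ q k u)) = 0.
Proof.
move=> nqp; apply: forms_eq => x; rewrite wQE ffunE.
case: eqP => // def_p; rewrite extdiffE big1 // => l _; rewrite wQE.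
case: eqP => [def_q|_]; last exact: mulr0.
by case/negP: nqp; rewrite -def_p -def_q; apply/s_homo/osupp_oface.
Qed.

Lemma wdiff_unit : extdiff F K 0 wunit = 0.
Proof.
apply: forms_eq => x; rewrite extdiffE ffunE !big_ord_recl big_ord0 !wunitE /=.
by rewrite !mulr1 addr0 expr0 expr1 subrr.
Qed.

Lemma wpi_unit p : wpi p wunit = 1.
Proof. by rewrite wpiE wunitE. Qed.

Lemma wpi_local p q u : ~~ le q p -> wpi p (wQ q 0%N u) = 0.
Proof.
move=> nqp; rewrite wpiE wQE; case: eqP => // def_q; case/negP: nqp.
by rewrite -def_q; apply/s_apex/osupp_opoint.
Qed.

Lemma wh_local p q r k u : le q p -> ~~ le r p ->
  wQ q k (wh p k (wQ r k.+1 u)) = 0.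
Proof.
move=> qp nrp; apply: forms_eq => x; rewrite wQE ffunE.
case: eqP => // def_q; rewrite whE; case vx: (oext _ _) => [y|] //=.
rewrite wQE; case: eqP => // def_r; case/negP: nrp; rewrite -def_r.
(* Coning a simplex carried below [p] stays below [p], so the cone cannot have carrier [r]. *)
by apply: (@s_apexU p (osimplex_simplex x)); rewrite -?def_q // in qp *;
  apply: osupp_oext.
Qed.

Lemma wh_diff_in p k u (x : osimplex K k) :
  apex p \in osupp x -> vsval (wh p k (extdiff F K k u)) x = 0.
Proof. by move=> vx; rewrite whE oext_none. Qed.

Lemma wh_diff0 p q u : le q p ->
  wQ q 0%N (wh p 0%N (extdiff F K 0 u)) =
    wQ q 0%N u - wpi p u *: wQ q 0%N wunit.
Proof.
move=> qp; apply: forms_eq => x.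
have -> : vsval (wQ q 0 u - wpi p u *: wQ q 0 wunit) x =
    vsval (wQ q 0 u) x - (wpi p u : F) * vsval (wQ q 0 wunit) x.
  by rewrite -scaleNr addrC linearP /= !ffunE addrC scaleNr.
rewrite !wQE; case: eqP => [def_q|_]; last by rewrite mulr0 subrr.
rewrite wunitE mulr1 wpiE.
have xp : le (so x) p by rewrite def_q.
have [vx|nvx] := boolP (apex p \in osupp x).
  (* A 0-simplex containing the apex is the base point itself, and both sides vanish. *)
  rewrite wh_diff_in //; have -> : opoint (apex p) = x; last by rewrite subrr.
  apply/val_inj/ffunP=> i; case/imsetP: vx => j _ ->.
  by rewrite ffunE [i]ord1 [j]ord1.
have [y vy] := oext_ex nvx (apex_complete xp).
rewrite whE vy /= extdiffE !big_ord_recl big_ord0 addr0 expr0 expr1.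
rewrite (oface0_oext vy) mul1r mulN1r; congr (_ - vsval u _).
apply/val_inj/ffunP=> i; rewrite !ffunE (oext_val vy) [i]ord1.
by rewrite (_ : lift _ _ = ord0) ?ocons0 //; apply/val_inj.
Qed.

Lemma wh_diffS p q k u : le q p ->
  wQ q k.+1 (extdiff F K k (wh p k u)) +
    wQ q k.+1 (wh p k.+1 (extdiff F K k.+1 u)) = wQ q k.+1 u.
Proof.
move=> qp; apply: forms_eq => x; rewrite linearD /= ffunE !wQE.
case: eqP => [def_q|_]; last by rewrite addr0.
have xp : le (so x) p by rewrite def_q.
rewrite extdiffE; have [vx|nvx] := boolP (apex p \in osupp x).
  (* Apex at place [m] of [x]: only the face omitting [m] has a nondegenerate cone, and the sign of
     reordering it into [x] cancels [(-1)^m]. *)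
  rewrite wh_diff_in // addr0; case/imsetP: vx => m _ def_v.
  rewrite (bigD1 m) //= big1 => [|l lm].
    rewrite whE def_v oext_oface_id /= addr0 (altformsP _ (subvsP u)).
    rewrite odd_lift_perm odd_perm1 addbF mulrA -signr_odd -signr_addb.
    by rewrite /= addbb mul1r.
  rewrite whE oext_none ?mulr0 //; have [i def_m _] := unlift_some lm.
  by rewrite def_v def_m; apply/imsetP; exists i; rewrite ?ffunE.
(* Apex outside [x]: the face of the cone opposite the apex returns [u x], and the other faces are
   cones over faces of [x], with signs opposite to those in [d h]. *)
have [y vy] := oext_ex nvx (apex_complete xp).
rewrite whE vy /= extdiffE [X in _ + X]big_ord_recl expr0 mul1r.
rewrite (oface0_oext vy) addrCA -big_split /= big1 ?addr0 // => l _.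
by rewrite whE (oext_oface l vy) /= exprS mulN1r mulNr subrr.
Qed.

Definition carried_whitney : carried le (whitney F K) :=
  @Carried _ _ _ (whitney F K) wQ wunit wpi wh wQ_sum wQ_orth
    wdiff_local wdiff_unit wpi_unit wpi_local wh_local wh_diff0 wh_diffS.

End CarriedWhitney.

(** * The two complexes of a product graph *)

Section Instances.
Variables (F : fieldType) (G H : sgraph).

Definition simplex_le (K : sgraph) : rel (simplex K) :=
  fun x y => simplex_set x \subset simplex_set y.

Lemma completeS (K : sgraph) (S T : {set K}) :
  S \subset T -> complete T -> complete S.
Proof.
move=> /subsetP ST /forall_inP T_cpl.
apply/forall_inP=> u /ST/T_cpl/forall_inP Tu.
by apply/forall_inP=> v /ST/Tu.
Qed.

Lemma simplex_ex (K : sgraph) (x : simplex K) : exists v, v \in simplex_set x.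
Proof. by apply/set0Pn; have /andP[] := simplexP x. Qed.

Definition simplex_vertex (K : sgraph) (x : simplex K) : K :=
  xchoose (simplex_ex x).

Lemma simplex_vertexP (K : sgraph) (x : simplex K) :
  simplex_vertex x \in simplex_set x.
Proof. exact: (xchooseP (simplex_ex x)). Qed.

(** The simplices contained in [p] are the faces of a full simplex, which is a cone from any of its
    vertices. *)
Definition carried_simplex (K : sgraph) :
  carried (@simplex_le K) (whitney F K).
Proof.
apply: (@carried_whitney F K _ _ id (@simplex_vertex K)) => //.
- by move=> p T defT; rewrite /simplex_le defT sub1set simplex_vertexP.
- move=> p S Sp; have /andP[_] := simplexP p; apply: completeS.
  by rewrite subUset sub1set simplex_vertexP.
- move=> p S T Sp defT.
  by rewrite /simplex_le defT subUset sub1set simplex_vertexP.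
Defined.

Local Notation cell_le := (prod_le (@simplex_le G) (@simplex_le H)).

Lemma prod_le_refl : reflexive cell_le.
Proof. by move=> p; rewrite /prod_le /simplex_le !subxx. Qed.

Lemma prod_le_trans : transitive cell_le.
Proof.
move=> q p r /andP[pq1 pq2] /andP[qr1 qr2].
by apply/andP; split; [apply: subset_trans qr1 | apply: subset_trans qr2].
Qed.

(** Vertices of [S] are pairwise comparable, so one of maximal total size is the largest. *)
Lemma chain_top_ex (S : simplex (prod_graph G H)) :
  exists p, (p \in simplex_set S) && [forall q in simplex_set S, cell_le q p].
Proof.
have [p0 p0S] := simplex_ex S.
pose size_of (p : prod_vert G H) := (#|simplex_set p.1| + #|simplex_set p.2|)%N.
have [p pS p_max] := @arg_maxnP _ p0 (mem (simplex_set S)) size_of p0S.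
exists p; rewrite [p \in _]pS; apply/forall_inP=> q qS.
have [->|nqp] := eqVneq q p; first exact: prod_le_refl.
have /andP[_ /forall_inP/(_ q qS)/forall_inP/(_ p pS)/implyP/(_ nqp)] :=
  simplexP S.
case/andP=> _ /orP[//|/andP[pq1 pq2]].
(* Remaining case, [p] below [q]: maximality of the size forces equality in both components. *)
have := p_max q qS; rewrite /size_of => le_qp.
have le1 := subset_leq_card pq1; have le2 := subset_leq_card pq2.
have eq1 : simplex_set p.1 == simplex_set q.1.
  by rewrite eqEcard pq1; lia.
have eq2 : simplex_set p.2 == simplex_set q.2.
  by rewrite eqEcard pq2; lia.
by rewrite /prod_le /simplex_le (eqP eq1) (eqP eq2) !subxx.
Qed.

Definition chain_top (S : simplex (prod_graph G H)) : simplex G * simplex H :=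
  xchoose (chain_top_ex S).

Lemma chain_topP (S : simplex (prod_graph G H)) p :
  reflect (forall q, q \in simplex_set S -> cell_le q p)
          (cell_le (chain_top S) p).
Proof.
have /andP[topS /forall_inP top_max] := xchooseP (chain_top_ex S).
apply: (iffP idP) => [top_p q qS|]; last by apply.
by apply: prod_le_trans top_p; apply: top_max.
Qed.

Lemma prod_le_adj (p q : prod_graph G H) : cell_le p q || cell_le q p ->
  (p != q) ==> adj p q.
Proof. by move=> pq; apply/implyP=> npq; rewrite /= /prod_adj npq. Qed.

(** Here [p] is itself a vertex of the product graph and serves as apex: it is comparable with every
    pair below it, so adding it to a chain below [p] gives a chain. *)
Definition carried_prod : carried cell_le (whitney F (prod_graph G H)).
Proof.
apply: (@carried_whitney F (prod_graph G H) _ _ chain_top id).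
- move=> S T /subsetP ST; apply/chain_topP=> q /ST qT.
  by move: q qT; apply/chain_topP; apply: prod_le_refl.
- move=> p T defT; apply/chain_topP=> q; rewrite defT => /set1P->.
  exact: prod_le_refl.
- move=> p S /chain_topP Sp; have /andP[_ /forall_inP S_cpl] := simplexP S.
  apply/forall_inP=> u /setU1P[->|uS]; apply/forall_inP=> v /setU1P[->|vS].
  + by rewrite eqxx.
  + by apply: prod_le_adj; rewrite (Sp v) ?orbT.
  + by apply: prod_le_adj; rewrite (Sp u).
  + exact: (forall_inP (S_cpl u uS)).
- move=> p S T /chain_topP Sp defT; apply/chain_topP=> q; rewrite defT.
  by case/setU1P=> [->|/Sp //]; apply: prod_le_refl.
Defined.

End Instances.

Theorem corollary10 (R : realType) (G H : sgraph) :
  exists (psi : chain_map (deRham R G H) (whitney R (prod_graph G H)))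
         (phi : chain_map (whitney R (prod_graph G H)) (deRham R G H)),
    chain_homotopic (chain_comp phi psi) (chain_id (deRham R G H)) /\
    chain_homotopic (chain_comp psi phi)
      (chain_id (whitney R (prod_graph G H))).
Proof.
have le_refl K : reflexive (@simplex_le K) by move=> x; apply: subxx.
apply: (carried_equivalence (@prod_le_refl G H) (@prod_le_trans G H)).
  exact: (carried_tensor (@le_refl G) (@le_refl H)
    (carried_simplex R G) (carried_simplex R H)).
exact: carried_prod.
Qed.
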